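(* Consider a facility-based system $(N,M,(A^i)_{i\in N},P)$ with $N=\{1,\dots,n\}$, $M=\{1,\dots,m\}$, a given performance criterion $P$, and set of profiles $A=\prod_{i=1}^nA^i=\{S_1,\dots,S_\ell\}$, $\ell=|A|$. Suppose that $M$ is the disjoint union $M=\Omega\cup\Omega_{\complement}$, $\Omega=\{i_1,\dots,i_t\}$, where the facility-cost functions $\Xi_j$, $j\in\Omega$, are prescribed, and only the facility-cost functions $\Xi_j$, $j\in\Omega_{\complement}$, can be designed. Then a set of facility-cost functions $(\Xi_j)_{j\in\Omega_{\complement}}$ can be found such that (together with the prescribed ones) the facility-based system becomes a congestion game with $P$ as its potential function if and only if the linear system $$\tilde B\,\tilde\Xi^{\mathrm{T}}=\tilde{\mathbf P},\qquad \tilde B=\begin{bmatrix}\tilde B(S_1)\\ \vdots\\ \tilde B(S_\ell)\end{bmatrix},\quad \tilde{\mathbf P}=\begin{bmatrix}\tilde P(S_1)\\ \vdots\\ \tilde P(S_\ell)\end{bmatrix},$$ in the unknown row vector $\tilde\Xi$ has at least one solution.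
   Context: A facility-based system (FBS) is a tuple $(N,M,(A^i)_{i\in N},P)$, where $N=\{1,\dots,n\}$ is the set of players, $M=\{1,\dots,m\}$ is the set of facilities, $A^i\subset 2^M$ is the strategy set of player $i$ (each strategy is a subset of $M$), $A:=\prod_{i=1}^nA^i$ is the set of profiles, and $P:A\to\mathbb{R}$ is the system performance criterion. For $a=(a^1,\dots,a^n)\in A$, $r_j(a):=|\{i:j\in a^i\}|$. Given facility-cost functions $\Xi_j:\mathbb{R}\to\mathbb{R}$, $j\in M$ (evaluated at $1,\dots,n$), the associated congestion game has payoff functions $c_i(a)=\sum_{j\in a^i}\Xi_j(r_j(a))$ and potential function $a\mapsto\sum_{j\in\bigcup_{i}a^i}\sum_{k=1}^{r_j(a)}\Xi_j(k)$. ''The FBS becomes a congestion game with $P$ as its potential function'' means that, with these facility-cost functions, this potential function equals $P$ on $A$. Write $\Xi_j=[\Xi_j(1),\dots,\Xi_j(n)]$ (row vector). For $j\in M$, $b_j(a)\in\mathbb{R}^n$ is the row vector whose first $r_j(a)$ entries are $1$ and remaining $n-r_j(a)$ entries are $0$. Define: - $\hat\Xi:=[\Xi_{i_1},\dots,\Xi_{i_t}]$, the concatenation of the prescribed $\Xi_j$, $j\in\Omega$, and $\hat B(a):=[b_{i_1}(a),\dots,b_{i_t}(a)]$; - $\tilde\Xi$, the concatenation of the vectors $\Xi_j$ over $j\in\Omega_{\complement}$ in increasing order of $j$ (i.e. $[\Xi_1,\dots,\Xi_m]$ with the blocks $i_1,\dots,i_t$ deleted), and $\tilde B(a)$, the concatenation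 of $b_j(a)$ over $j\in\Omega_{\complement}$ in the same order; - $\tilde P(a):=P(a)-\hat B(a)\hat\Xi^{\mathrm{T}}$. *)

(* Defs.v *)
From HB Require Import structures.
From mathcomp Require Import all_boot all_order all_algebra reals.

Set Implicit Arguments.
Unset Strict Implicit.
Unset Printing Implicit Defensive.

Import GRing.Theory.
Local Open Scope ring_scope.

(* Players and facilities are numbered from 0: N = 'I_n and M = 'I_m. *)
Definition profile (n m : nat) (A : 'I_n -> {set {set 'I_m}}) : Type :=
  {a : {ffun 'I_n -> {set 'I_m}} | [forall i, a i \in A i]}.

Definition strat (n m : nat) (A : 'I_n -> {set {set 'I_m}})
  (a : profile A) (i : 'I_n) : {set 'I_m} := val a i.

Record fbs (R : realType) (n m : nat) := FBS {
  strategies : 'I_n -> {set {set 'I_m}};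
  criterion : profile strategies -> R }.

Section Congestion.
Variables (R : realType) (n m : nat) (A : 'I_n -> {set {set 'I_m}}).
Implicit Types (a : profile A) (j : 'I_m).

Definition load j a : nat := #|[set i : 'I_n | j \in strat a i]|.

Definition potential (Xi : 'I_m -> R -> R) a : R :=
  \sum_(j in \bigcup_(i < n) strat a i)
    \sum_(1 <= k < (load j a).+1) Xi j k%:R.

(* [xi(1), ..., xi(n)]; the column index k starts at 0. *)
Definition cost_row (xi : R -> R) : 'rV[R]_n := \row_(k < n) xi k.+1%:R.

Definition load_row j a : 'rV[R]_n := \row_(k < n) (k < load j a)%N%:R.

End Congestion.

(* The payoffs c_i(a) = \sum_(j in a^i) Xi j (r_j(a)) are determined by Xi, and
   the congestion game they define always admits [potential Xi]; what is
   required is that this potential be the performance criterion. *)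
Definition congestion_game_with_potential (R : realType) (n m : nat)
    (F : fbs R n m) (Xi : 'I_m -> R -> R) : Prop :=
  forall a : profile (strategies F), potential Xi a = criterion a.

Section LinearSystem.
Variables (R : realType) (n m : nat) (F : fbs R n m).
Local Notation prof := (profile (strategies F)).

(* idx lists the facilities i_1, ..., i_t whose cost functions are prescribed,
   and xi k is the cost function of idx k. *)
Section Prescribed.
Variables (t : nat) (idx : 'I_t -> 'I_m) (xi : 'I_t -> R -> R).

Definition hatXi : 'rV[R]_(\sum_(k < t) n) := \mxrow_(k < t) cost_row n (xi k).

Definition hatB (a : prof) : 'rV[R]_(\sum_(k < t) n) :=
  \mxrow_(k < t) load_row R (idx k) a.

Definition tildeP (a : prof) : R := criterion a - (hatB a *m hatXi^T) 0 0.

End Prescribed.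

(* enum_val lists the elements of a set of ordinals in increasing order. *)
Definition tildeB (OmegaC : {set 'I_m}) (a : prof) :
    'rV[R]_(\sum_(k < #|OmegaC|) n) :=
  \mxrow_(k < #|OmegaC|) load_row R (enum_val k) a.

End LinearSystem.

(* Main.v *)
Require Import Defs.
From HB Require Import structures.
From mathcomp Require Import all_boot all_order all_algebra reals.

Set Implicit Arguments.
Unset Strict Implicit.
Unset Printing Implicit Defensive.

Import GRing.Theory.
Local Open Scope ring_scope.

(** Fix a profile a.  A facility that nobody uses has load 0 and contributes an
    empty sum to the potential, so the potential is a sum over all facilities
    of the contributions Xi_j(1) + ... + Xi_j(r_j(a)), each of which is the
    product of the 0/1 row b_j(a) with the transposed row Xi_j.  Splitting the
    facilities into the prescribed and the free ones makes the potential
    the sum of two block products ([potential_split]), the first of which is a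
    known number.  Hence P is the potential at a exactly when the row of the
    linear system at a holds for the free block of the given cost functions
    ([potential_eq_criterion]); since S enumerates every profile, the system
    holds exactly when P is the potential everywhere.

    This proves one direction.  For the other one, a solution of the linear
    system is only a list of numbers, and has to come from cost functions on
    the reals: any n values can be interpolated at 1, ..., n
    ([interpolateK]), and the resulting functions glue with the prescribed ones
    because no facility is both free and prescribed
    ([exists_extension]). *)

Section PotentialAsProduct.
Variables (R : realType) (n m : nat) (A : 'I_n -> {set {set 'I_m}}).
Implicit Types (a : profile A) (j : 'I_m) (Xi : 'I_m -> R -> R).

Lemma load_le j a : (load j a <= n)%N.
Proof. by rewrite -[leqRHS]card_ord max_card. Qed.

Lemma load_unused j a : j \notin \bigcup_(i < n) strat a i -> load j a = 0%N.
Proof.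
move=> jNa; apply/eqP; rewrite cards_eq0; apply/eqP/setP=> i; rewrite !inE.
by apply: contraNF jNa => ji; apply/bigcupP; exists i.
Qed.

Lemma load_row_mul_cost_row j a (f : R -> R) :
  (load_row R j a *m (cost_row n f)^T) 0 0
  = \sum_(1 <= k < (load j a).+1) f k%:R.
Proof.
rewrite mxE big_add1 /= big_mkord (big_ord_widen _ (fun k => f k.+1%:R) (load_le j a)).
rewrite [RHS]big_mkcond; apply: eq_bigr => k _; rewrite !mxE.
by case: ifP; rewrite ?mul1r ?mul0r.
Qed.

Lemma potential_sum_products Xi a :
  potential Xi a = \sum_j (load_row R j a *m (cost_row n (Xi j))^T) 0 0.
Proof.
rewrite /potential big_mkcond; apply: eq_bigr => j _.
rewrite load_row_mul_cost_row; case: ifPn => // /load_unused ->.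
by rewrite big_geq.
Qed.

End PotentialAsProduct.

Lemma mxrow_mul_tr (R : pzRingType) (p n : nat) (u v : 'I_p -> 'rV[R]_n) :
  ((\mxrow_(k < p) u k) *m (\mxrow_(k < p) v k)^T) 0 0
  = \sum_(k < p) (u k *m (v k)^T) 0 0.
Proof. by rewrite tr_mxrow mul_mxrow_mxcol summxE. Qed.

Section Interpolation.
Variables (R : realType) (n : nat).

Definition interpolate (v : 'rV[R]_n) (x : R) : R :=
  \sum_(k < n | x == k.+1%:R) v 0 k.

(** The nodes 1, ..., n are pairwise distinct in characteristic 0, so only one
    term of the sum survives at each of them. *)
Lemma interpolateK (v : 'rV[R]_n) : cost_row n (interpolate v) = v.
Proof.
apply/rowP=> k; rewrite mxE /interpolate (big_pred1 k) // => i.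
by rewrite /= Num.Theory.eqr_nat eqSS eq_sym.
Qed.

End Interpolation.

Section Splitting.
Variables (R : realType) (n m : nat) (F : fbs R n m).
Variables (Omega OmegaC : {set 'I_m}).
Hypothesis Omega_cover : Omega :|: OmegaC = [set: 'I_m].
Hypothesis Omega_disjoint : [disjoint Omega & OmegaC].
Variables (t : nat) (idx : 'I_t -> 'I_m).
Hypothesis idx_inj : injective idx.
Hypothesis Omega_idx : Omega = [set idx k | k : 'I_t].
Variable xi : 'I_t -> R -> R.

Definition tildeXi_of (Xi : 'I_m -> R -> R) : 'rV[R]_(\sum_(k < #|OmegaC|) n) :=
  \mxrow_(k < #|OmegaC|) cost_row n (Xi (enum_val k)).

(** Both block products expand into sums over indices of blocks; idx and
    enum_val are bijections onto the two parts of the partition, and turn them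
    into the two halves of the sum over all facilities. *)
Lemma potential_split (Xi : 'I_m -> R -> R) (a : profile (strategies F)) :
  (forall k, Xi (idx k) = xi k) ->
  potential Xi a = (hatB idx a *m (hatXi n xi)^T) 0 0
                   + (tildeB OmegaC a *m (tildeXi_of Xi)^T) 0 0.
Proof.
move=> Xi_idx; rewrite potential_sum_products.
rewrite /hatB /hatXi /tildeB /tildeXi_of !mxrow_mul_tr.
have cover : xpredT =1 [predU Omega & OmegaC].
  by move=> j; rewrite /= -in_setU Omega_cover inE.
rewrite (eq_bigl _ _ cover) bigU //; congr (_ + _).
  rewrite Omega_idx big_imset /=; last by move=> ? ? _ _; apply: idx_inj.
  by apply: eq_bigr => k _; rewrite Xi_idx.
by rewrite big_enum_val.
Qed.

Lemma potential_eq_criterion (Xi : 'I_m -> R -> R) (a : profile (strategies F)) :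
  (forall k, Xi (idx k) = xi k) ->
  potential Xi a = criterion a <->
  (tildeB OmegaC a *m (tildeXi_of Xi)^T) 0 0 = tildeP idx xi a.
Proof.
move=> Xi_idx; rewrite (potential_split a Xi_idx) /tildeP.
(* Unification in the ring rewriting must not unfold the matrix products. *)
move: ((hatB _ _ *m _) _ _) => p.
move: ((tildeB _ _ *m _) _ _) => q.
by split=> [<-|->]; rewrite addrC ?addKr ?addrNK.
Qed.

Lemma exists_extension (w : 'rV[R]_(\sum_(k < #|OmegaC|) n)) :
  exists Xi : 'I_m -> R -> R,
    (forall k, Xi (idx k) = xi k) /\ tildeXi_of Xi = w.
Proof.
exists (fun j => if [pick k | idx k == j] is Some k then xi k
        else if [pick k : 'I_#|OmegaC| | enum_val k == j] is Some k
             then interpolate (submxrow w k) else fun=> 0).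
split=> [k|].
  by case: pickP => [l /eqP/idx_inj -> //|/(_ k)]; rewrite eqxx.
rewrite -[RHS]submxrowK; apply: eq_mxrow => k.
case: pickP => [l /eqP idx_l|_].
  have /(disjointFr Omega_disjoint) : enum_val k \in Omega.
    by rewrite Omega_idx -idx_l imset_f.
  by rewrite enum_valP.
case: pickP => [l /eqP/enum_val_inj ->|/(_ k)]; last by rewrite eqxx.
exact: interpolateK.
Qed.

End Splitting.

Theorem mainTheorem4 (R : realType) (n m : nat) (F : fbs R n m)
  (S : 'I_#|{: profile (strategies F)}| -> profile (strategies F))
  (S_bij : bijective S)
  (Omega OmegaC : {set 'I_m})
  (Omega_cover : Omega :|: OmegaC = [set: 'I_m])
  (Omega_disjoint : [disjoint Omega & OmegaC])
  (t : nat) (idx : 'I_t -> 'I_m) (idx_inj : injective idx)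
  (Omega_idx : Omega = [set idx k | k : 'I_t])
  (xi : 'I_t -> R -> R) :
  (exists Xi : 'I_m -> R -> R,
      (forall k : 'I_t, Xi (idx k) = xi k) /\
      congestion_game_with_potential F Xi)
  <->
  (exists tildeXi : 'rV[R]_(\sum_(k < #|OmegaC|) n),
      (\matrix_(k < #|{: profile (strategies F)}|) tildeB OmegaC (S k))
        *m tildeXi^T
      = \col_(k < #|{: profile (strategies F)}|) tildeP idx xi (S k)).
Proof.
have row_eq (w : 'rV_(\sum_(k < #|OmegaC|) n)) k :
    ((\matrix_k tildeB OmegaC (S k)) *m w^T) k 0
    = (tildeB OmegaC (S k) *m w^T) 0 0.
  by rewrite !mxE; apply: eq_bigr => l _; rewrite mxE.
have game_row Xi (a : profile (strategies F)) :=
  @potential_eq_criterion R n m F Omega OmegaC Omega_cover Omega_disjoint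
    t idx idx_inj Omega_idx xi Xi a.
split=> [[Xi [Xi_idx game]]|[w w_sol]].
  exists (tildeXi_of n OmegaC Xi); apply/colP=> k.
  by rewrite row_eq [RHS]mxE; apply/game_row.
have [Xi [Xi_idx XiE]] := exists_extension Omega_disjoint idx_inj Omega_idx xi w.
exists Xi; split=> // a; apply/game_row => //; rewrite XiE.
have [S' _ SK] := S_bij; rewrite -(SK a) -row_eq w_sol.
by rewrite mxE.
Qed.
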